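(* Let $m\ge 2$, $n\ge 2$, let $S_m$ be the star $K_{1,m}$ and $P_n$ the path on $n$ vertices, and let $\Delta$ be the maximum degree of $S_m\times P_n$. Then $$\chi''_{\Sigma}(S_m\times P_n)=\begin{cases}\Delta+1 & \text{if } n=3,\\ \Delta+2 & \text{if } n=2 \text{ or } n\ge 4.\end{cases}$$
   Context: All graphs are finite and simple. A proper total $k$-coloring of a graph $G$ assigns to every vertex and every edge a color from $\{1,\dots,k\}$ such that adjacent vertices receive different colors, edges sharing an endpoint receive different colors, and no edge receives the same color as either of its endpoints. For such a coloring $c$ and a vertex $v$, let $f(v)=c(v)+\sum_{e\ni v} c(e)$. The coloring distinguishes adjacent vertices by sums if $f(u)\neq f(v)$ for every edge $uv$. $\chi''_{\Sigma}(G)$ denotes the smallest $k$ such that $G$ has a proper total $k$-coloring distinguishing adjacent vertices by sums. The product $G_1\times G_2$ is the Cartesian product: vertex set $V(G_1)\times V(G_2)$, with $(u_1,u_2)$ adjacent to $(v_1,v_2)$ iff either $u_1=v_1$ and $u_2v_2\in E(G_2)$, or $u_1v_1\in E(G_1)$ and $u_2=v_2$. The star $S_m$ has a central vertex adjacent to $m$ leaves (so $S_2=P_3$). *)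

(* Defs.v *)
From HB Require Import structures.
From mathcomp Require Import all_boot.

Set Implicit Arguments.
Unset Strict Implicit.
Unset Printing Implicit Defensive.

Record sgraph := SGraph {
  vertex :> finType;
  adj : rel vertex;
  adj_sym : symmetric adj;
  adj_irrefl : irreflexive adj }.

Definition edges (G : sgraph) : {set {set G}} :=
  [set e : {set G} | [exists u, exists v, adj u v && (e == [set u; v])]].

Definition degree (G : sgraph) (v : G) : nat := #|[set w : G | adj v w]|.

Definition max_degree (G : sgraph) : nat := \max_(v : G) degree v.

Section TotalColoring.
Variable G : sgraph.

(* Only the values of [ce] on [edges G] are ever used. *)
Definition proper_total_coloring (k : nat) (cv : G -> nat)
    (ce : {set G} -> nat) : bool :=
  [&& [forall v, 0 < cv v <= k],
      [forall e in edges G, 0 < ce e <= k],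
      [forall u, forall v, adj u v ==> (cv u != cv v)],
      [forall e1 in edges G, forall e2 in edges G,
         (e1 != e2) && (e1 :&: e2 != set0) ==> (ce e1 != ce e2)]
    & [forall e in edges G, forall v in e, ce e != cv v]].

Definition color_sum (cv : G -> nat) (ce : {set G} -> nat) (v : G) : nat :=
  cv v + \sum_(e in edges G | v \in e) ce e.

Definition sum_distinguishing (cv : G -> nat) (ce : {set G} -> nat) : bool :=
  [forall u, forall v, adj u v ==> (color_sum cv ce u != color_sum cv ce v)].

(* The finite type ['I_k.+1] only serves to make the predicate boolean; the
   color 0 is excluded by [proper_total_coloring]. See [sum_total_colorableP]. *)
Definition sum_total_colorable (k : nat) : bool :=
  [exists cv : {ffun G -> 'I_k.+1}, exists ce : {ffun {set G} -> 'I_k.+1},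
     proper_total_coloring k (fun v => cv v) (fun e => ce e) &&
     sum_distinguishing (fun v => cv v) (fun e => ce e)].

Lemma sum_total_colorableP (k : nat) :
  reflect (exists (cv : G -> nat) (ce : {set G} -> nat),
             proper_total_coloring k cv ce /\ sum_distinguishing cv ce)
          (sum_total_colorable k).
Proof.
apply: (iffP existsP) => [[cv /existsP[ce /andP[H1 H2]]]|[cv [ce []]]].
  by exists (fun v => nat_of_ord (cv v)), (fun e => nat_of_ord (ce e)).
case/and5P=> /forallP cvk /forall_inP cek /forallP Hv /forall_inP He /forall_inP Hve.
move=> /forallP Hs.
pose cv' := [ffun v => inord (cv v) : 'I_k.+1].
pose ce' := [ffun e => inord (ce e) : 'I_k.+1].
have cvE v : cv' v = cv v :> nat.
  by rewrite ffunE inordK // ltnS; case/andP: (cvk v).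
have ceE e : e \in edges G -> ce' e = ce e :> nat.
  by move=> eG; rewrite ffunE inordK // ltnS; case/andP: (cek e eG).
have csE v : color_sum (fun v => cv' v) (fun e => ce' e) v = color_sum cv ce v.
  by rewrite /color_sum cvE; congr (_ + _); apply: eq_bigr => e /andP[/ceE].
exists cv'; apply/existsP; exists ce'; apply/andP; split; last first.
  by apply/forallP=> u; apply/forallP=> v; rewrite !csE; exact: (forallP (Hs u)).
apply/and5P; split.
- by apply/forallP=> v; rewrite cvE.
- by apply/forall_inP=> e eG; rewrite ceE //; exact: cek.
- by apply/forallP=> u; apply/forallP=> v; rewrite !cvE; exact: (forallP (Hv u)).
- apply/forall_inP=> e1 e1G; apply/forall_inP=> e2 e2G; rewrite !ceE //.
  exact: (forall_inP (He e1 e1G)).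
- apply/forall_inP=> e eG; apply/forall_inP=> v ve; rewrite ceE // cvE.
  exact: (forall_inP (Hve e eG)).
Qed.

Lemma sum_total_colorable_ex : exists k, sum_total_colorable k.
Proof.
pose N := #|G|.+1.
pose cv (v : G) : nat := (enum_rank v).+1.
pose ce (e : {set G}) : nat := (enum_rank e).+1 * N.
have cvN v : cv v < N by rewrite /cv /N ltnS.
have cvI : injective cv by move=> u v [] /ord_inj /enum_rank_inj.
have ceI : injective ce.
  move=> e1 e2 /eqP; rewrite /ce eqn_pmul2r // eqSS => /eqP.
  by move/ord_inj/enum_rank_inj.
have ceN e : ce e %% N = 0 by rewrite /ce modnMl.
have adjN u v : adj u v -> u != v.
  by move=> uv; apply/eqP=> E; rewrite E adj_irrefl in uv.
exists (N + #|{set G}| * N); apply/sum_total_colorableP; exists cv, ce; split.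
  apply/and5P; split.
  - by apply/forallP=> v; rewrite /= (leq_trans (ltnW (cvN v))) ?leq_addr.
  - apply/forall_inP=> e _; rewrite /ce muln_gt0 /=.
    by apply: (leq_trans _ (leq_addl _ _)); rewrite leq_mul2r ltn_ord orbT.
  - apply/forallP=> u; apply/forallP=> v; apply/implyP=> /adjN.
    by apply: contra_neq => /cvI.
  - apply/forall_inP=> e1 _; apply/forall_inP=> e2 _; apply/implyP=> /andP[+ _].
    by apply: contra_neq => /ceI.
  - apply/forall_inP=> e _; apply/forall_inP=> v _; apply/eqP=> E.
    by have := ceN e; rewrite E modn_small.
apply/forallP=> u; apply/forallP=> v; apply/implyP=> /adjN.
apply: contra_neq => E; apply: cvI.
have csN w : color_sum cv ce w %% N = cv w.
  rewrite /color_sum -modnDmr.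
  have /eqP-> : N %| \sum_(e in edges G | w \in e) ce e.
    by apply: dvdn_sum => e _; rewrite /ce dvdn_mull.
  by rewrite addn0 modn_small.
by rewrite -csN E csN.
Qed.

Definition sum_total_chromatic_number : nat := ex_minn sum_total_colorable_ex.

End TotalColoring.

Section CartesianProduct.
Variables G1 G2 : sgraph.

Definition cart_adj : rel (G1 * G2) := fun u v =>
  ((u.1 == v.1) && adj u.2 v.2) || (adj u.1 v.1 && (u.2 == v.2)).

Lemma cart_adj_sym : symmetric cart_adj.
Proof.
move=> u v; rewrite /cart_adj (adj_sym u.1) (adj_sym u.2).
by rewrite (eq_sym u.1) (eq_sym u.2).
Qed.

Lemma cart_adj_irrefl : irreflexive cart_adj.
Proof. by move=> u; rewrite /cart_adj !adj_irrefl !andbF. Qed.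

Definition cart_prod : sgraph := SGraph cart_adj_sym cart_adj_irrefl.
End CartesianProduct.

Section Star.
Variable m : nat.

(* [None] is the center and [Some i] are the [m] leaves. *)
Definition star_adj : rel (option 'I_m) := fun u v => isSome u != isSome v.

Lemma star_adj_sym : symmetric star_adj.
Proof. by move=> u v; rewrite /star_adj eq_sym. Qed.

Lemma star_adj_irrefl : irreflexive star_adj.
Proof. by move=> u; rewrite /star_adj eqxx. Qed.

Definition star_graph : sgraph := SGraph star_adj_sym star_adj_irrefl.
End Star.

Section Path.
Variable n : nat.

Definition path_adj : rel 'I_n := fun i j => (i.+1 == j) || (j.+1 == i).

Lemma path_adj_sym : symmetric path_adj.
Proof. by move=> i j; rewrite /path_adj orbC. Qed.

Lemma path_adj_irrefl : irreflexive path_adj.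
Proof. by move=> i; rewrite /path_adj orbb gtn_eqF. Qed.

Definition path_graph : sgraph := SGraph path_adj_sym path_adj_irrefl.
End Path.

(* Main.v *)
Require Import Defs.
From HB Require Import structures.
From mathcomp Require Import all_boot zify.

(** Lower bound: a vertex of degree [d] sees [d + 1] distinct colors, so with
    [d + 1] colors its sum is [1 + ... + (d + 1)]; two adjacent vertices of
    maximum degree would then have equal sums. Such a pair exists unless
    [n = 3].

    Upper bound: with [b = 3] (for [n <= 3]) or [b = 4] (for [n >= 4]), give
    every star edge of leaf [i] the color [b + 1 + i] in all layers, and color
    the copies of the path with [1, ..., b] only, using one pattern for the
    center and another one for all leaves. The star edges contribute the same
    amount to all vertices of a copy of the path, so sums need only be compared
    within the two patterns; a center is separated from its leaves because it
    sees at least two star edges. *)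

Set Implicit Arguments.
Unset Strict Implicit.
Unset Printing Implicit Defensive.

(** * Colors seen at a vertex, and total colorings of an arbitrary graph *)

Section Generalities.
Variable G : sgraph.
Implicit Types (u v w : G) (cv : G -> nat) (ce : {set G} -> nat).

Lemma adj_neq u v : adj u v -> u != v.
Proof. by apply: contraTneq => ->; rewrite adj_irrefl. Qed.

Lemma edgesP (e : {set G}) :
  reflect (exists u v, adj u v /\ e = [set u; v]) (e \in edges G).
Proof.
rewrite inE; apply: (iffP existsP) => [[u /existsP[v /andP[uv /eqP->]]]|].
  by exists u, v.
by case=> u [v [uv ->]]; exists u; apply/existsP; exists v; rewrite uv eqxx.
Qed.

Lemma mem_edges u v : adj u v -> [set u; v] \in edges G.
Proof. by move=> uv; apply/edgesP; exists u, v. Qed.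

Lemma edges_at u (e : {set G}) :
  e \in edges G -> u \in e -> exists2 v, adj u v & e = [set u; v].
Proof.
case/edgesP=> x [y [xy ->]]; rewrite !inE => /orP[]/eqP->; first by exists y.
by exists x; rewrite 1?adj_sym // setUC.
Qed.

(** Lets the edges at [u] be indexed by the neighbors of [u], both in sums and in palettes. *)
Lemma set2_inj u : {in [pred v | adj u v] &, injective (fun v => [set u; v])}.
Proof.
move=> v w; rewrite !inE => uv uw /setP/(_ v).
rewrite !inE eqxx orbT eq_sym (negPf (adj_neq uv)) /=.
by move/esym/eqP.
Qed.

Lemma sum_edges_at ce u :
  \sum_(e in edges G | u \in e) ce e = \sum_(v | adj u v) ce [set u; v].
Proof.
rewrite -(big_imset _ (@set2_inj u)) /=; apply: eq_bigl => e.
apply/andP/imsetP => [[eG ue]|[v uv ->]].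
  by have [v uv ->] := edges_at eG ue; exists v.
by rewrite mem_edges // !inE eqxx.
Qed.

Lemma degreeE u : degree u = \sum_(v | adj u v) 1.
Proof. by rewrite sum1_card; apply: eq_card => v; rewrite !inE. Qed.

(** A list rather than a set: [sumn] then yields the color sum, while [uniq] records properness
    around [u]. *)
Definition palette cv ce u : seq nat :=
  cv u :: [seq ce [set u; v] | v <- enum [pred v | adj u v]].

Lemma size_palette cv ce u : size (palette cv ce u) = (degree u).+1.
Proof.
by rewrite /= size_map -cardE degreeE sum1_card.
Qed.

Lemma sumn_palette cv ce u : sumn (palette cv ce u) = color_sum cv ce u.
Proof.
rewrite /= /color_sum sum_edges_at sumnE big_map big_enum_cond /=.
by congr (_ + _); apply: eq_bigl => v; rewrite andbT.
Qed.

Lemma palette_uniq k cv ce u :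
  proper_total_coloring k cv ce -> uniq (palette cv ce u).
Proof.
case/and5P=> _ _ _ /forall_inP He /forall_inP Hve.
rewrite /= map_inj_in_uniq ?enum_uniq ?andbT.
  apply/mapP=> -[v]; rewrite mem_enum => uv /esym/eqP; apply/negP.
  by apply: (forall_inP (Hve _ (mem_edges uv))); rewrite !inE eqxx.
move=> v w; rewrite !mem_enum => uv uw /eqP; apply: contraTeq => vw.
have /forall_inP/(_ _ (mem_edges uw))/implyP := He _ (mem_edges uv); apply.
apply/andP; split; first by apply: contraNneq vw => /set2_inj->.
by apply/set0Pn; exists u; rewrite !inE eqxx.
Qed.

Lemma palette_sub k cv ce u :
  proper_total_coloring k cv ce -> {subset palette cv ce u <= iota 1 k}.
Proof.
case/and5P=> /forallP Hv /forall_inP He _ _ _ x.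
rewrite mem_iota add1n ltnS inE => /predU1P[->|/mapP[v]]; first exact: Hv.
by rewrite mem_enum => uv ->; apply: He; apply: mem_edges.
Qed.

Lemma degree_lt_colors k u : sum_total_colorable G k -> degree u < k.
Proof.
case/sum_total_colorableP=> cv [ce [Hp _]].
rewrite -(size_palette cv ce u) -(size_iota 1 k).
exact: uniq_leq_size (palette_uniq u Hp) (palette_sub Hp).
Qed.

(** A duplicate-free list of length [k] inside [iota 1 k] is a permutation of it, so the sum no
    longer depends on the coloring. *)
Lemma color_sum_full_palette k cv ce u :
  proper_total_coloring k cv ce -> k = (degree u).+1 ->
  color_sum cv ce u = sumn (iota 1 k).
Proof.
move=> Hp kE; rewrite -sumn_palette; apply/perm_sumn/uniq_perm.
- exact: palette_uniq Hp.
- exact: iota_uniq.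
have [|_ //] := uniq_min_size (palette_uniq u Hp) (palette_sub Hp).
by rewrite size_iota size_palette kE.
Qed.

Lemma adjacent_max_degree_not_colorable u v :
  adj u v -> degree u = degree v -> ~~ sum_total_colorable G (degree u).+1.
Proof.
move=> uv duv; apply/sum_total_colorableP=> -[cv [ce [Hp /forallP/(_ u)]]].
move/forallP/(_ v); rewrite uv /=.
rewrite (color_sum_full_palette Hp) // (color_sum_full_palette (u := v) Hp) ?duv //.
by rewrite eqxx.
Qed.

Lemma sum_total_chromatic_number_eq k :
  sum_total_colorable G k ->
  (forall l, sum_total_colorable G l -> k <= l) ->
  sum_total_chromatic_number G = k.
Proof.
move=> Hk Hl; rewrite /sum_total_chromatic_number; case: ex_minnP => l Gl Hmin.
by apply/eqP; rewrite eqn_leq Hl // Hmin.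
Qed.

Lemma max_degree_eq d u :
  degree u = d -> (forall v, degree v <= d) -> max_degree G = d.
Proof.
move=> <- Hd; apply/eqP; rewrite eqn_leq /max_degree leq_bigmax andbT.
by apply/bigmax_leqP=> v _; apply: Hd.
Qed.

(* Edge colorings are functions on two-element sets; the maximum turns a
   symmetric function of the end points into one. *)
Lemma sum_total_colorable_of_pairs k cv (c : G -> G -> nat) :
  (forall u v, c u v = c v u) ->
  (forall u, 0 < cv u <= k) ->
  (forall u v, adj u v -> 0 < c u v <= k) ->
  (forall u v, adj u v -> cv u != cv v) ->
  (forall u v w, adj u v -> adj u w -> v != w -> c u v != c u w) ->
  (forall u v, adj u v -> c u v != cv u) ->
  (forall u v, adj u v -> cv u + \sum_(w | adj u w) c u w
                       != cv v + \sum_(w | adj v w) c v w) ->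
  sum_total_colorable G k.
Proof.
move=> cC cvk ck cvP cP cvcP cS.
pose ce (e : {set G}) :=
  \max_(p : G * G | (p.1 \in e) && (p.2 \in e) && adj p.1 p.2) c p.1 p.2.
(* Only the ordered pairs [(u, v)] and [(v, u)] enter the maximum, since loops are excluded by
   irreflexivity; by [cC] both have the same value. *)
have ceE u v : adj u v -> ce [set u; v] = c u v.
  move=> uv; apply/eqP; rewrite eqn_leq /ce; apply/andP; split.
    apply/bigmax_leqP=> -[x y] /=; rewrite !inE => /andP[/andP[]].
    by move=> /orP[]/eqP-> /orP[]/eqP->; rewrite ?adj_irrefl // cC.
  apply: (@leq_bigmax_cond _ _ (fun p : G * G => c p.1 p.2) (u, v)).
  by rewrite /= !inE !eqxx orbT.
have csE u : color_sum cv ce u = cv u + \sum_(w | adj u w) c u w.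
  by rewrite /color_sum sum_edges_at; congr (_ + _); apply: eq_bigr => w /ceE.
apply/sum_total_colorableP; exists cv, ce; split; last first.
  apply/forallP=> u; apply/forallP=> v; apply/implyP=> uv; rewrite !csE.
  exact: cS.
apply/and5P; split.
- exact/forallP.
- by apply/forall_inP=> e /edgesP[u [v [uv ->]]]; rewrite ceE ?ck.
- by apply/forallP=> u; apply/forallP=> v; apply/implyP/cvP.
- apply/forall_inP=> e1 e1G; apply/forall_inP=> e2 e2G; apply/implyP.
  case/andP=> ne /set0Pn[u]; rewrite inE => /andP[ue1 ue2].
  have [v uv E1] := edges_at e1G ue1; have [w uw E2] := edges_at e2G ue2.
  rewrite {}E1 {}E2 in ne *; rewrite !ceE // cP //.
  by apply: contraNneq ne => ->.
- apply/forall_inP=> e eG; apply/forall_inP=> u ue.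
  by have [v uv ->] := edges_at eG ue; rewrite ceE ?cvcP.
Qed.

End Generalities.

(** * Sums over neighborhoods in products, stars and paths *)

Lemma sum_cart_adj (G1 G2 : sgraph) (u : cart_prod G1 G2) (F : G1 * G2 -> nat) :
  \sum_(w | adj u w) F w =
  \sum_(b | adj u.2 b) F (u.1, b) + \sum_(a | adj u.1 a) F (a, u.2).
Proof.
(* Irreflexivity leaves exactly one disjunct of [cart_adj] possible on each side of this split. *)
rewrite (bigID (fun w : G1 * G2 => u.1 == w.1)) /=; congr (_ + _).
  rewrite (reindex_onto (fun b => (u.1, b)) snd) /=.
    apply: eq_bigl => b; rewrite /cart_adj /= !eqxx adj_irrefl /=.
    by rewrite orbF !andbT.
  by case=> a b /= /andP[_ /eqP->].
rewrite (reindex_onto (fun a => (a, u.2)) fst) /=.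
  apply: eq_bigl => a; rewrite /cart_adj /= !eqxx adj_irrefl andbF /= !andbT.
  by case ua: (adj u.1 a); rewrite //= (adj_neq ua).
case=> a b /= /andP[]; rewrite /cart_adj /=.
by case: (u.1 == a) => //= /andP[_ /eqP->].
Qed.

Lemma sum_star_center m (F : option 'I_m -> nat) :
  \sum_(a | star_adj None a) F a = \sum_(i < m) F (Some i).
Proof.
rewrite (reindex_omap Some id) => [|[i|] //]; apply: eq_bigl => i.
by rewrite /star_adj /= eqxx.
Qed.

Lemma sum_star_leaf m (i : 'I_m) (F : option 'I_m -> nat) :
  \sum_(a | star_adj (Some i) a) F a = F None.
Proof. by rewrite (big_pred1 None) // => -[]. Qed.

(* A path edge is indexed by its smaller end. *)
Definition path_edge_sum n (q : nat -> nat) (j : nat) : nat :=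
  (if 0 < j then q j.-1 else 0) + (if j.+1 < n then q j else 0).

Lemma sum_path_adj n (j : 'I_n) (q : nat -> nat) :
  \sum_(b | path_adj j b) q (minn j b) = path_edge_sum n q j.
Proof.
(* Predecessor against successor: each part has at most one term, and none at the corresponding end
   of the path. *)
rewrite (bigID (fun b : 'I_n => b.+1 == j)) /=; congr (_ + _).
  case: ifP => j0.
    have jn : j.-1 < n by have := ltn_ord j; lia.
    rewrite (big_pred1 (Ordinal jn)) /= => [|b]; first by congr q; lia.
    rewrite /= -[RHS]val_eqE /path_adj /=; apply/idP/idP; lia.
  by rewrite big1 // => b; rewrite /path_adj; lia.
case: ifP => jn.
  rewrite (big_pred1 (Ordinal jn)) /= => [|b]; first by congr q; lia.
  rewrite /= -[RHS]val_eqE /path_adj /=; apply/idP/idP; lia.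
by rewrite big1 // => b; rewrite /path_adj; have := ltn_ord b; lia.
Qed.

(** * Colorings of the product built from two path patterns *)

Section StarPath.
Variables m n : nat.
Notation SP := (cart_prod (star_graph m) (path_graph n)).

Lemma degree_star_path (u : SP) :
  degree u = path_edge_sum n (fun=> 1) u.2 + (if u.1 is Some _ then 1 else m).
Proof.
case: u => a j; rewrite degreeE (@sum_cart_adj (star_graph m) (path_graph n) (a, j) (fun=> 1)) /=.
rewrite (sum_path_adj j (fun=> 1)); congr (_ + _).
case: a => [i|]; first by rewrite sum_star_leaf.
by rewrite sum_star_center sum_nat_const card_ord muln1.
Qed.

(* In [cv s] and [cq s] the flag [s] is [false] for the center and [true] for
   the leaves; [cq s j] is the color of the edge from layer [j] to [j.+1]. *)
Variables (b : nat) (cv cq : bool -> nat -> nat).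

Definition row_sum s j := cv s j + path_edge_sum n (cq s) j.

(** The last branch serves the path edges; the values given to nonadjacent pairs are junk. *)
Definition star_path_color (u v : SP) : nat :=
  match u.1, v.1 with
  | None, Some i | Some i, None => b.+1 + i
  | _, _ => cq (isSome u.1) (minn u.2 v.2)
  end.

Lemma sum_star_path_color (u : SP) :
  cv (isSome u.1) u.2 + \sum_(w | adj u w) star_path_color u w =
  row_sum (isSome u.1) u.2 +
  (if u.1 is Some i then b.+1 + i else \sum_(i < m) (b.+1 + i)).
Proof.
case: u => a j; rewrite (@sum_cart_adj (star_graph m) (path_graph n) (a, j)) /= addnA /row_sum.
rewrite /star_path_color /=; congr (_ + _ + _); case: a => [i|] /=.
- exact: sum_path_adj.
- exact: sum_path_adj.
- exact: sum_star_leaf.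
- by rewrite sum_star_center.
Qed.

(** Since [2 <= m], the center has a second star edge, whose color is at least [b.+1]. *)
Lemma sum_rungs_gt (i : 'I_m) :
  2 <= m -> b.+1 + i + b < \sum_(i < m) (b.+1 + i).
Proof.
move=> hm; rewrite (bigD1 i) //= -addnS leq_add2l.
have [i' ne] : exists i' : 'I_m, i' != i.
  have h0 : 0 < m by lia.
  have [i0|i0] := eqVneq (val i) 0; last first.
    by exists (Ordinal h0); rewrite -val_eqE eq_sym.
  by exists (Ordinal hm); rewrite -val_eqE /= i0.
by rewrite (bigD1 i') //= -addnA leq_addr.
Qed.

Hypothesis hm : 2 <= m.
Hypothesis cv_range : forall s j, j < n -> 0 < cv s j <= b.
Hypothesis cq_range : forall s j, j.+1 < n -> 0 < cq s j <= b.
Hypothesis cv_next : forall s j, j.+1 < n -> cv s j != cv s j.+1.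
Hypothesis cq_next : forall s j, j.+2 < n -> cq s j != cq s j.+1.
Hypothesis cq_cv : forall s j, j.+1 < n ->
  (cq s j != cv s j) && (cq s j != cv s j.+1).
Hypothesis cv_leaf : forall j, j < n -> cv false j != cv true j.
Hypothesis row_sum_next : forall s j, j.+1 < n -> row_sum s j != row_sum s j.+1.
(** By [sum_rungs_gt] the star edges put the center ahead of a leaf by more than [b], so a deficit
    of up to [b] in the row sums is harmless. *)
Hypothesis row_sum_leaf : forall j, j < n ->
  row_sum true j <= row_sum false j + b.

Lemma star_path_colorable : sum_total_colorable SP (b + m).
Proof.
have rung (i : 'I_m) : b < b.+1 + i <= b + m by have := ltn_ord i; lia.
have leb x : 0 < x <= b -> 0 < x <= b + m by lia.
have gtb x i : 0 < x <= b -> b.+1 + i != x by lia.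
have leaf_center x y (i : 'I_m) : x <= y + b ->
    x + (b.+1 + i) != y + \sum_(i' < m) (b.+1 + i').
  by have := sum_rungs_gt i hm; lia.
(* Orients every edge, because the hypotheses on the patterns only compare layer [j] with layer
   [j.+1]. *)
have adjP (u v : SP) : adj u v ->
    [\/ exists a (j l : 'I_n), [/\ u = (a, j), v = (a, l) & j.+1 = l],
        exists a (j l : 'I_n), [/\ u = (a, j), v = (a, l) & l.+1 = j],
        exists i (j : 'I_n), u = (None, j) /\ v = (Some i, j)
      | exists i (j : 'I_n), u = (Some i, j) /\ v = (None, j)].
  case: u v => a j [a' l]; rewrite /adj /= /cart_adj /=.
  case/orP=> /andP[]; last first.
    case: a a' => [i|] [i'|] //= _ /eqP->; first by constructor 4; exists i, l.
    by constructor 3; exists i', l.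
  move/eqP=> <- /orP[]/eqP jl; first by constructor 1; exists a, j, l.
  by constructor 2; exists a, j, l.
have cC u v : star_path_color u v = star_path_color v u.
  rewrite /star_path_color minnC.
  by case: u v => [[i|] j] [[i'|] l].
have rowE a (j l : 'I_n) : star_path_color (a, j) (a, l) = cq (isSome a) (minn j l).
  by case: a.
apply: (@sum_total_colorable_of_pairs SP _
          (fun u => cv (isSome u.1) u.2) star_path_color) => //.
- by case=> a j /=; apply/leb/cv_range/ltn_ord.
- move=> u v /adjP[] => [[a [j [l [-> -> E]]]]|[a [j [l [-> -> E]]]]||].
  + rewrite rowE -E (minn_idPl _) //.
    by have := ltn_ord l; rewrite -E => /(cq_range (isSome a))/leb.
  + rewrite rowE -E (minn_idPr _) //.
    by have := ltn_ord j; rewrite -E => /(cq_range (isSome a))/leb.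
  + by case=> i [j [-> ->]]; rewrite /star_path_color /=; have := rung i; lia.
  + by case=> i [j [-> ->]]; rewrite /star_path_color /=; have := rung i; lia.
- move=> u v /adjP[] => [[a [j [l [-> -> E]]]]|[a [j [l [-> -> E]]]]||] /=.
  + by have := ltn_ord l; rewrite -E => /(cv_next (isSome a)).
  + by have := ltn_ord j; rewrite -E eq_sym => /(cv_next (isSome a)).
  + by case=> i [j [-> ->]]; apply: cv_leaf.
  + by case=> i [j [-> ->]]; rewrite eq_sym; apply: cv_leaf.
- have rowN a (j l1 l2 : 'I_n) : j.+1 = l1 -> l2.+1 = j ->
      star_path_color (a, j) (a, l1) != star_path_color (a, j) (a, l2).
    move=> E1 E2; have := ltn_ord l1; rewrite -E1 -E2 => /(cq_next (isSome a)).
    by rewrite !rowE -E1 -E2 (minn_idPl _) // (minn_idPr _) // eq_sym.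
  have rowR a (j l : 'I_n) i : path_adj j l ->
      star_path_color (a, j) (a, l) != b.+1 + i.
    move=> jl; have mn : (minn j l).+1 < n.
      by move: jl; rewrite /path_adj; have := ltn_ord j; have := ltn_ord l; lia.
    by rewrite rowE eq_sym; apply/gtb/cq_range.
  case=> a j [a1 j1] [a2 j2]; rewrite /adj /= /cart_adj /=.
  (* An equal first coordinate means a path edge, a different one a star edge. Mixed pairs are
     separated by the threshold [b], and two distinct star edges can meet only at a center. *)
  have [<-{a1}|a1a] /= := eqVneq a a1; have [<-{a2}|a2a] /= := eqVneq a a2.
  + rewrite /star_adj !eqxx !orbF => /orP[]/eqP h1 /orP[]/eqP h2 ne.
    * by case/negP: ne; apply/eqP; congr (_, _); apply: val_inj; rewrite /= -h1.
    * exact: rowN.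
    * by rewrite eq_sym; apply: rowN.
    * case/negP: ne; apply/eqP; congr (_, _); apply: val_inj => /=; lia.
  + rewrite /star_adj !eqxx !orbF => h1 /andP[h2 /eqP<-] _.
    by have := rowR a j j1; case: a a2 a2a h2 => [i|] [i'|] // _ _; apply.
  + rewrite /star_adj !eqxx !orbF => /andP[h2 /eqP<-] h1 _; rewrite eq_sym.
    by have := rowR a j j2; case: a a1 a1a h2 => [i|] [i'|] // _ _; apply.
  + move=> /andP[h1 /eqP<-] /andP[h2 /eqP<-].
    case: a a1 a2 h1 h2 {a1a a2a} => [i|] [i1|] [i2|] //= _ _.
      by rewrite eqxx.
    by apply: contra_neq; rewrite /star_path_color /= => /addnI/val_inj->.
- move=> u v /adjP[] => [[a [j [l [-> -> E]]]]|[a [j [l [-> -> E]]]]||].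
  + rewrite rowE -E (minn_idPl _) //=.
    by have := ltn_ord l; rewrite -E => /(cq_cv (isSome a))/andP[].
  + rewrite rowE -E (minn_idPr _) //=.
    by have := ltn_ord j; rewrite -E => /(cq_cv (isSome a))/andP[].
  + case=> i [j [-> ->]]; rewrite /star_path_color /=.
    exact/gtb/cv_range/ltn_ord.
  + case=> i [j [-> ->]]; rewrite /star_path_color /=.
    exact/gtb/cv_range/ltn_ord.
- move=> u v uv; rewrite !sum_star_path_color.
  case: (adjP _ _ uv) => [[a [j [l [-> -> E]]]]|[a [j [l [-> -> E]]]]||] /=.
  + rewrite eqn_add2r -E.
    by have := ltn_ord l; rewrite -E => /(row_sum_next (isSome a)).
  + rewrite eqn_add2r -E eq_sym.
    by have := ltn_ord j; rewrite -E => /(row_sum_next (isSome a)).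
  + case=> i [j [-> ->]] /=.
    by rewrite eq_sym; apply: leaf_center (row_sum_leaf (ltn_ord j)).
  + case=> i [j [-> ->]] /=.
    exact: leaf_center (row_sum_leaf (ltn_ord j)).
Qed.

End StarPath.

(** * Maximum degrees and explicit patterns *)

Section StarPathBounds.
Variable m : nat.
Hypothesis hm : 2 <= m.

Lemma max_degree_star_path2 :
  max_degree (cart_prod (star_graph m) (path_graph 2)) = m.+1.
Proof.
apply: (@max_degree_eq (cart_prod (star_graph m) (path_graph 2)) _ (None, ord0)); first by rewrite degree_star_path.
case=> a j; rewrite degree_star_path /path_edge_sum /=.
by have := ltn_ord j; case: a => [_|]; do 2 case: ifP; lia.
Qed.

Lemma max_degree_star_path n :
  max_degree (cart_prod (star_graph m) (path_graph n.+3)) = m.+2.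
Proof.
apply: (@max_degree_eq (cart_prod (star_graph m) (path_graph n.+3)) _
          (None, Ordinal (isT : 1 < n.+3))).
  by rewrite degree_star_path.
case=> a j; rewrite degree_star_path /path_edge_sum /=.
by case: a => [_|]; do 2 case: ifP; lia.
Qed.

Lemma star_path2_colorable :
  sum_total_colorable (cart_prod (star_graph m) (path_graph 2)) m.+3.
Proof.
pose cv s j := nth 0 (if s then [:: 3; 1] else [:: 1; 3]) j.
pose cq (s : bool) (j : nat) := 2.
rewrite -[m.+3]/(3 + m).
by apply: (@star_path_colorable m 2 3 cv cq) => //;
  (case=> [] [|[|j]] //) || (case=> [|[|j]] //).
Qed.

Lemma star_path3_colorable :
  sum_total_colorable (cart_prod (star_graph m) (path_graph 3)) m.+3.
Proof.
(* Row sums are 3, 6, 3 on the center and 5, 6, 5 on the leaves. With three colors an interior layer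
   always gives 6, which is harmless here as there is only one. *)
pose cv s j := nth 0 (if s then [:: 3; 1; 2] else [:: 2; 3; 1]) j.
pose cq s j := nth 0 (if s then [:: 2; 3] else [:: 1; 2]) j.
rewrite -[m.+3]/(3 + m).
by apply: (@star_path_colorable m 3 3 cv cq) => //;
  (case=> [] [|[|[|j]]] //) || (case=> [|[|[|j]]] //).
Qed.

Lemma star_path_colorable_add4 n :
  2 < n -> sum_total_colorable (cart_prod (star_graph m) (path_graph n)) m.+4.
Proof.
move=> hn.
(* Leaf copies have odd vertices and even edges, center copies the opposite; parity thus excludes
   every vertex-edge and center-leaf conflict. *)
pose cv s j := if s then (if odd j then 3 else 1) else (if odd j then 4 else 2).
pose cq s j := if s then (if odd j then 4 else 2) else (if odd j then 3 else 1).
rewrite -[m.+4]/(4 + m).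
apply: (@star_path_colorable m n 4 cv cq) => //; rewrite /cv /cq.
- by case=> j _; case: (odd j).
- by case=> j _; case: (odd j).
- by case=> j _ /=; case: (odd j).
- by case=> j _ /=; case: (odd j).
- by case=> j _ /=; case: (odd j).
- by move=> j _; case: (odd j).
(* Interior row sums alternate between 7 and 9 on leaves and between 6 and 8 on the center; the
   first layer gives 3 and the last 5. *)
- move=> s [|j] jn; rewrite /row_sum /path_edge_sum /= jn.
    by rewrite hn; case: s.
  by rewrite negbK; case: s; case: (odd j) => /=; case: ifP; lia.
- move=> [|j] jn; rewrite /row_sum /path_edge_sum /=; first by case: ifP.
  by case: (odd j) => /=; case: ifP.
Qed.

End StarPathBounds.

Theorem theorem4p3 (m n : nat) (hm : 2 <= m) (hn : 2 <= n) :
  (n = 3 ->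
     sum_total_chromatic_number (cart_prod (star_graph m) (path_graph n)) =
     max_degree (cart_prod (star_graph m) (path_graph n)) + 1) /\
  (n = 2 \/ 4 <= n ->
     sum_total_chromatic_number (cart_prod (star_graph m) (path_graph n)) =
     max_degree (cart_prod (star_graph m) (path_graph n)) + 2).
Proof.
have lower (G : sgraph) (u v : G) l : adj u v -> degree u = degree v ->
    sum_total_colorable G l -> (degree u).+2 <= l.
  move=> uv duv Gl; rewrite ltn_neqAle (degree_lt_colors u Gl) andbT.
  by apply: contraTneq Gl => <-; apply: adjacent_max_degree_not_colorable uv duv.
split=> [->|].
  rewrite max_degree_star_path // addn1; apply: sum_total_chromatic_number_eq.
    exact: star_path3_colorable.
  (* The center of the middle layer has degree [m.+2], which already forces [m.+3] colors. *)
  move=> l /(@degree_lt_colors (cart_prod (star_graph m) (path_graph 3)) _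
                             (None, Ordinal (isT : 1 < 3))).
  by rewrite degree_star_path.
case=> [->|].
  rewrite max_degree_star_path2 // addn2; apply: sum_total_chromatic_number_eq.
    exact: star_path2_colorable.
  move=> l /(lower (cart_prod (star_graph m) (path_graph 2))
                   (None, ord0) (None, ord_max)).
  by rewrite !degree_star_path /=; apply.
case: n hn => [|[|[|[|n]]]] // _ _.
rewrite max_degree_star_path // addn2; apply: sum_total_chromatic_number_eq.
  exact: star_path_colorable_add4.
(* Layers 1 and 2 are both interior, so their centers are adjacent vertices of maximum degree. *)
move=> l /(lower (cart_prod (star_graph m) (path_graph n.+4))
                 (None, Ordinal (isT : 1 < n.+4)) (None, Ordinal (isT : 2 < n.+4))).
by rewrite !degree_star_path /=; apply.
Qed.
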